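(* Let $G$ be a group with a fixed finite generating set $S$, and let $s = |S|$. Then $$\mathrm{F\o l}_{G,S}(k) \leq (2s+1)^{R_{G,S}^{ps}(1)}$$ whenever $k$ and $p$ are natural numbers, $k \geq 1$, with $(3/4)^p < 1/(2ks)$, where $R_{G,S}^{ps}$ denotes the $ps$-fold composition of the function $R_{G,S}$ with itself.
   Context: $S$ is a nonempty finite generating set of $G$, not required to be closed under inversion. $B_n$ denotes the set of elements of $G$ whose distance from the identity is at most $n$ in the word metric determined by $S$ (word length in the letters $S \cup S^{-1}$). For finite $A \subseteq G$ and $\epsilon > 0$, a finite nonempty set $B \subseteq G$ is $\epsilon$-Følner with respect to $A$ if $\sum_{a \in A} |(aB) \triangle B| \leq \epsilon |B|$, where $aB=\{ab : b\in B\}$. $\mathrm{F\o l}_{G,S}(k)$ is the minimum cardinality of a $1/k$-Følner set with respect to $S$. For a finite set $A \subseteq G$, $P(A)$ is the set of probability measures on $A$, regarded as measures on $G$ concentrated on $A$. The product of finitely supported measures is $\mu\nu(E) = \sum_{xy \in E}\mu(\{x\})\nu(\{y\})$, and $P(A)\nu = \{\mu\nu : \mu \in P(A)\}$. For finite $A, B \subseteq G$ and $\epsilon>0$, $B$ is $\epsilon$-Ramsey with respect to $A$ if for every $E \subseteq B$ there is a $\nu \in P(B)$ such that $P(A)\nu \subseteq P(B)$ and $|\mu\nu(E) - \mu'\nu(E)| \leq \epsilon$ for all $\mu,\mu' \in P(A)$. $R_{G,S}(m)$ is the minimum $n$ such that $B_n$ is $\frac12$-Ramsey with respect to $B_m$.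 Minima over empty sets are taken to be $\infty$, with $R_{G,S}(\infty)=\infty$ and $(2s+1)^\infty=\infty$. *)

(* Defs.v *)
From HB Require Import structures.
From mathcomp Require Import all_boot all_order all_algebra finmap.
From mathcomp Require Import boolp classical_sets functions cardinality reals.

Set Implicit Arguments.
Unset Strict Implicit.
Unset Printing Implicit Defensive.

Import Order.TTheory GRing.Theory Num.Theory.

Local Open Scope fset_scope.
Local Open Scope ring_scope.

(* Extended naturals: [None] stands for infinity. *)
Definition enat := option nat.

Definition enat_le (x y : enat) : bool :=
  match x, y with
  | _, None => true
  | None, Some _ => false
  | Some m, Some n => (m <= n)%N
  end.

(* The minimum of a set of naturals, with min(empty) = infinity. *)
Definition enat_min (A : nat -> Prop) : enat :=
  if pselect (exists n, `[< A n >]) is left h then Some (ex_minn h) else None.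

(* The conventions f(oo) = oo and b^oo = oo. *)
Definition enat_ext (f : nat -> enat) (x : enat) : enat := obind f x.
Definition enat_exp (b : nat) (x : enat) : enat := omap (expn b) x.

Lemma enat_min_Some (A : nat -> Prop) (n : nat) :
  enat_min A = Some n <-> A n /\ (forall m, A m -> (n <= m)%N).
Proof.
rewrite /enat_min; case: pselect => [h|nh]; last first.
  by split=> // -[An _]; case: nh; exists n; apply/asboolP.
case: ex_minnP => m /asboolP Am mmin; split=> [[<-]|[An nmin]].
  by split=> // l Al; apply: mmin; apply/asboolP.
by congr Some; apply/eqP; rewrite eqn_leq nmin // mmin //; apply/asboolP.
Qed.

Lemma enat_min_None (A : nat -> Prop) :
  enat_min A = None <-> forall n, ~ A n.
Proof.
rewrite /enat_min; case: pselect => [h|nh]; split=> //.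
- by move=> noA; have [n /asboolP /noA] := h.
- by move=> _ n An; apply: nh; exists n; apply/asboolP.
Qed.

Section WordMetric.
Variables (G : groupType) (S : {fset G}).

(* Words in the letters of S and their inverses. *)
Definition is_word (w : seq G) : bool :=
  all (fun x => (x \in S) || ((x^-1)%g \in S)) w.

Definition word_prod (w : seq G) : G := (\prod_(x <- w) x)%g.

Definition generates : Prop :=
  forall g : G, exists2 w : seq G, is_word w & word_prod w = g.

(* The distance from g to the identity in the word metric. *)
Definition word_length (g : G) : enat :=
  enat_min (fun n => exists w : seq G,
    [/\ is_word w, word_prod w = g & size w = n]).

Definition word_ball (n : nat) : {fset G} :=
  fset_set [set g : G | enat_le (word_length g) (Some n)]%classic.

Lemma word_length_le (g : G) (n : nat) :
  enat_le (word_length g) (Some n) <->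
  exists w : seq G, [/\ is_word w, word_prod w = g & (size w <= n)%N].
Proof.
case E: (word_length g) => [m|] /=.
  have /enat_min_Some[[w [Sw wg wm]] mmin] := E.
  split=> [mn|[v [Sv vg vn]]]; first by exists w; rewrite wm.
  by apply: leq_trans vn; apply: mmin; exists v.
split=> // -[w [Sw wg _]].
by have /enat_min_None/(_ (size w)) := E; case; exists w.
Qed.

Lemma finite_word_ball (n : nat) :
  finite_set [set g : G | enat_le (word_length g) (Some n)]%classic.
Proof.
pose L := S `|` [fset (x^-1)%g | x in S].
pose B := iter n (fun B => [fset (1%g : G)] `|`
  [fset (x * y)%g | x in L, y in B]) [fset (1%g : G)].
apply: (@sub_finite_set _ _ [set` B]); last exact: finite_fset.
move=> g /word_length_le[w [Sw <- {g}]] /=.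
rewrite {}/B; elim: n w Sw => [|n IHn] [|x w] //=; rewrite /word_prod.
- by rewrite big_nil inE.
- by rewrite big_nil !inE eqxx.
- move=> /andP[Sx Sw] wn; rewrite big_cons inE; apply/orP; right.
  apply/imfset2P; exists x => /=; last by exists (word_prod w) => //; apply: IHn.
  case/orP: Sx => Sx; rewrite !inE ?Sx //; apply/orP; right.
  by apply/imfsetP; exists (x^-1)%g; rewrite ?invgK.
Qed.

Lemma in_word_ball (n : nat) (g : G) :
  (g \in word_ball n) = enat_le (word_length g) (Some n).
Proof.
rewrite /word_ball in_fset_set; last exact: finite_word_ball.
by apply/idP/idP; rewrite inE.
Qed.

End WordMetric.

Section Folner.
Variables (R : realType) (G : groupType).
Implicit Types (A B S : {fset G}).

Definition fset_translate (a : G) (B : {fset G}) : {fset G} :=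
  [fset (a * b)%g | b in B].

Definition fset_symdiff (A B : {fset G}) : {fset G} := (A `\` B) `|` (B `\` A).

Definition is_folner (eps : R) (A B : {fset G}) : Prop :=
  B != fset0 /\
  \sum_(a <- A) #|` fset_symdiff (fset_translate a B) B|%:R
    <= eps * #|` B|%:R.

Definition folner_fun (S : {fset G}) (k : nat) : enat :=
  enat_min (fun n => exists2 B : {fset G},
    is_folner (1 / k%:R) S B & #|` B| = n).

End Folner.

Section Ramsey.
Variables (R : realType) (G : groupType).

(* Finitely supported measures on G, given by their point masses. *)
Definition fmeasure := {fsfun G -> R with 0}.

Definition fmeasure_of (mu : fmeasure) (E : {fset G}) : R :=
  \sum_(x <- E) mu x.

Definition is_prob_on (A : {fset G}) (mu : fmeasure) : Prop :=
  [/\ finsupp mu `<=` A, forall x, 0 <= mu x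
    & fmeasure_of mu A = 1].

Definition fmeasure_prod (mu nu : fmeasure) : fmeasure :=
  [fsfun z in [fset (x * y)%g | x in finsupp mu, y in finsupp nu] =>
    \sum_(x <- finsupp mu) \sum_(y <- finsupp nu | (x * y)%g == z) mu x * nu y
  | 0].

Lemma fmeasure_prodE (mu nu : fmeasure) (E : {fset G}) :
  fmeasure_of (fmeasure_prod mu nu) E =
  \sum_(x <- finsupp mu) \sum_(y <- finsupp nu | (x * y)%g \in E) mu x * nu y.
Proof.
have prodE z : fmeasure_prod mu nu z = \sum_(x <- finsupp mu)
    \sum_(y <- finsupp nu | (x * y)%g == z) mu x * nu y.
  rewrite fsfun_fun; case: ifPn => // /negP zN.
  rewrite big_seq big1 // => x xmu; rewrite big_seq_cond big1 // => y.
  by case/andP=> ynu /eqP xyz; case: zN; apply/imfset2P; exists x => //; exists y.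
rewrite /fmeasure_of; under eq_bigr do rewrite prodE.
rewrite exchange_big; apply: eq_bigr => x _ /=.
under eq_bigr do rewrite big_mkcond.
rewrite exchange_big [RHS]big_mkcond; apply: eq_bigr => y _ /=.
case: ifPn => xyE.
  rewrite (big_fsetD1 _ xyE) /= eqxx big_seq big1 ?addr0 // => z.
  by rewrite !inE eq_sym => /andP[/negbTE ->].
rewrite big_seq big1 // => z zE; case: eqP => // xyz.
by rewrite xyz zE in xyE.
Qed.

Definition is_ramsey (eps : R) (A B : {fset G}) : Prop :=
  forall E : {fset G}, E `<=` B ->
  exists nu : fmeasure, [/\ is_prob_on B nu,
    forall mu, is_prob_on A mu -> is_prob_on B (fmeasure_prod mu nu)
  & forall mu mu', is_prob_on A mu -> is_prob_on A mu' ->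
      `| fmeasure_of (fmeasure_prod mu nu) E
         - fmeasure_of (fmeasure_prod mu' nu) E | <= eps].

Definition ramsey_fun (S : {fset G}) (m : nat) : enat :=
  enat_min (fun n => is_ramsey (1 / 2) (word_ball S m) (word_ball S n)).

Definition ramsey_iter (S : {fset G}) (j : nat) (x : enat) : enat :=
  iter j (enat_ext (ramsey_fun S)) x.

End Ramsey.

(* Main.v *)
(* One Ramsey step contracts the oscillation of a function by 3/4: threshold it
   at the midpoint of its range and apply the Ramsey property to the upper level
   set. Running [p] steps for each generator gives, for any family of functions
   [f_a] with values in [0, 1] ([a] in [S]), a measure [nu] on the ball with
   [f_a (a nu) - f_a nu <= (3/4)^p] for all [a] at once. A minimax argument
   exchanges the quantifiers over [nu] and [f], so that a single [nu] has
   [sum_a ||(a nu - nu)^+||_1 < 1/(2k)], and a layer-cake decomposition of [nu]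
   yields a level set that is Folner. *)
Require Import Defs.
From HB Require Import structures.
From mathcomp Require Import all_boot all_order all_algebra finmap.
From mathcomp Require Import boolp classical_sets functions cardinality reals.
From mathcomp Require Import ring lra.

Set Implicit Arguments.
Unset Strict Implicit.
Unset Printing Implicit Defensive.

Import Order.TTheory GRing.Theory Num.Theory.

Local Open Scope fset_scope.
Local Open Scope ring_scope.

(** * Smoothed positive parts and a minimax inequality *)

Definition clamp (R : realType) (x : R) : R := Num.min 1 (Num.max 0 x).

(* [x * s - d * s ^+ 2 / 2] maximized over [s] in [0, 1]: a smooth approximation
   of the positive part, whose derivative is the maximizer [clamp (x / d)]. *)
Definition huber (R : realType) (d x : R) : R :=
  x * clamp (x / d) - d * clamp (x / d) ^+ 2 / 2.

Lemma clamp_itv (R : realType) (x : R) : 0 <= clamp x <= 1.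
Proof. by rewrite /clamp le_min ler01 le_max lexx ge_min lexx. Qed.

(** First-order optimality: [clamp (x / d)] maximizes a concave function on [[0, 1]], whose
    derivative there, [x - d * clamp (x / d)], is nonpositive in every feasible direction. *)
Lemma clamp_opt (R : realType) (d x t : R) : 0 < d -> 0 <= t <= 1 ->
  (x - d * clamp (x / d)) * (t - clamp (x / d)) <= 0.
Proof.
move=> d0 /andP[t0 t1]; rewrite /clamp.
have dt0 : 0 <= d * t by nra.
have dt1 : 0 <= d * (1 - t) by nra.
have xE : x = d * (x / d) by rewrite mulrC divfK // gt_eqF.
move: (x / d) xE => y ->; case: (leP 0 y) => y0; [case: (leP 1 y) | case: (leP 1 0)] => y1; nra.
Qed.

Lemma huber_ge0 (R : realType) (d x : R) : 0 < d -> 0 <= huber d x.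
Proof.
move=> d0; rewrite /huber.
have /andP[c0 c1] := clamp_itv (x / d).
have := @clamp_opt _ d x 0 d0; rewrite lexx ler01 => /(_ isT).
by move: (clamp _) c0 c1 => s c0 c1 ?; nra.
Qed.

Lemma huber_le (R : realType) (d x : R) : 0 < d -> huber d x <= clamp (x / d) * x.
Proof.
move=> d0; rewrite /huber; move: (clamp _) => s.
have : 0 <= d * s ^+ 2 by rewrite mulr_ge0 ?sqr_ge0 // ltW.
by move=> ?; lra.
Qed.

Lemma pos_part_le_huber (R : realType) (d x : R) : 0 < d ->
  Num.max 0 x <= huber d x + d.
Proof.
move=> d0; rewrite ge_max addr_ge0 ?huber_ge0 ?ltW //= /huber.
have /andP[c0 c1] := clamp_itv (x / d).
have := @clamp_opt _ d x 1 d0; rewrite lexx ler01 => /(_ isT).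
move: (clamp _) c0 c1 => s c0 c1 opt.
have : 0 <= d * s ^+ 2 by rewrite mulr_ge0 ?sqr_ge0 // ltW.
have : 0 <= d * (1 - s) by rewrite mulr_ge0 ?subr_ge0 // ltW.
by move=> ? ?; nra.
Qed.

(** The quadratic upper bound for a function with [1 / d]-Lipschitz derivative. It reduces to
    [clamp_opt] at [x], tested against [clamp (y / d)], and a square. *)
Lemma huber_smooth (R : realType) (d x y : R) : 0 < d ->
  huber d y <= huber d x + clamp (x / d) * (y - x) + (y - x) ^+ 2 / (2 * d).
Proof.
move=> d0; rewrite /huber; have := @clamp_opt _ d x _ d0 (clamp_itv (y / d)).
move: (clamp (x / d)) (clamp (y / d)) => s t st.
pose z := (y - x) / d; have -> : y = x + d * z by rewrite /z; field; rewrite gt_eqF.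
have -> : (x + d * z - x) ^+ 2 / (2 * d) = d * z ^+ 2 / 2 by field; rewrite gt_eqF.
have : 0 <= d * (t - s - z) ^+ 2 by rewrite mulr_ge0 ?sqr_ge0 // ltW.
by move=> ?; nra.
Qed.

(* Smoothing the positive part makes the minimax elementary: a near-minimizer
   over [X] of the sum of Huber functions, moved slightly towards the answer to
   its own gradient (a Frank-Wolfe step), improves unless its value is about
   [c] or less. *)
Lemma minimax_pos_part (R : realType) (I : Type) (r : seq I)
    (X : (I -> R) -> Prop) (c e : R) :
    (forall x i, X x -> `|x i| <= 1) ->
    (forall (x y : I -> R) (t : R), X x -> X y -> 0 <= t <= 1 ->
      X (fun i => (1 - t) * x i + t * y i)) ->
    (forall f : I -> R, (forall i, 0 <= f i <= 1) ->
      exists2 x, X x & \sum_(i <- r) f i * x i <= c) ->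
    0 < e ->
  exists2 x, X x & \sum_(i <- r) Num.max 0 (x i) <= c + e.
Proof.
move=> X1 Xconv Xf e0; pose b : R := (size r)%:R.
have sumb (a : R) : \sum_(i <- r) a = a * b.
  by rewrite big_const_seq count_predT iter_addr_0 mulr_natr.
have b0 : 0 <= b by rewrite ler0n.
have [d d0 db] : exists2 d : R, 0 < d & d * b <= e / 2.
  exists (e / (2 * (b + 1))); first by rewrite divr_gt0 //; lra.
  rewrite mulrAC ler_pdivrMr; last by lra.
  by nra.
pose Phi (x : I -> R) := \sum_(i <- r) huber d (x i).
pose V : set R := [set v | exists2 x, X x & v = Phi x]%classic.
have V0 : has_inf V.
  split; last first.
    by exists 0 => _ [x _ ->]; apply: sumr_ge0 => i _; apply: huber_ge0.
  by have [x Xx _] := Xf (fun=> 0) (fun=> (introT andP (conj (lexx _) ler01)));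
    exists (Phi x), x.
(* In units of [g ^+ 2], [2 * b / d] is the second-order error of a step of size [g]. The extra [2]
   pays for using twice that [Phi x] is within [g * g] of the infimum. *)
pose C := 2 + 2 * b / d.
have C0 : 0 < C.
  have : 0 <= 2 * b / d by apply: divr_ge0; [apply: mulr_ge0 | apply: ltW].
  by rewrite /C => ?; lra.
pose g := Num.min 1 (e / (2 * C)).
have g0 : 0 < g by rewrite lt_min ltr01 divr_gt0 // mulr_gt0.
have g1 : g <= 1 by rewrite ge_min lexx.
have gC : g * C <= e / 2.
  rewrite -ler_pdivlMr //; apply: le_trans (_ : e / (2 * C) <= _).
    by rewrite ge_min lexx orbT.
  by rewrite le_eqVlt; apply/orP; left; apply/eqP; field; rewrite gt_eqF.
have [_ [x Xx ->] xlt] := inf_adherent (mulr_gt0 g0 g0) V0.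
have [|y Xy yc] := Xf (fun i => clamp (x i / d)); first by move=> i; apply: clamp_itv.
pose z i := (1 - g) * x i + g * y i.
have Xz : X z by apply: Xconv => //; rewrite ltW.
have mz : inf V <= Phi z by apply: ge_inf; [case: V0 | exists z].
have zx : Phi z <= Phi x + (\sum_(i <- r) g * (clamp (x i / d) * y i - huber d (x i)))
   + \sum_(i <- r) (2 * g ^+ 2 / d).
  rewrite /Phi -!big_split /=; apply: ler_sum => i _.
  have zE : z i - x i = g * (y i - x i) by rewrite /z; ring.
  apply: le_trans (huber_smooth (x i) _ d0) _; rewrite zE.
  apply: lerD.
    rewrite lerD2l; have := huber_le (x i) d0.
    by move: (huber _ _) (clamp _) => h s ?; nra.
  rewrite invfM mulrA ler_wpM2r ?invr_ge0 ?(ltW d0) //.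
  have := X1 _ i Xx; have := X1 _ i Xy; rewrite !ler_norml.
  move=> /andP[? ?] /andP[? ?].
  have : (y i - x i) ^+ 2 <= 4 by nra.
  by rewrite exprMn; have := sqr_ge0 g => ? ?; nra.
exists x => //.
apply: le_trans (_ : Phi x + d * b <= _).
  rewrite -sumb -big_split /=; apply: ler_sum => i _; exact: pos_part_le_huber.
suff : Phi x <= c + g * C by lra.
move: zx; rewrite -big_distrr /= sumrB sumb -/(Phi x) => zx.
have : 2 * g ^+ 2 / d * b = g ^+ 2 * (C - 2) by rewrite /C; field; rewrite gt_eqF.
move=> E; rewrite E in zx.
have: g * inf V <= g * (c + g * (C - 1)) by nra.
rewrite ler_pM2l // => ?.
nra.
Qed.

(** * Weighted lists and oscillation *)

(* Finitely supported measures are weighted lists, in which points may repeat: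
   products and mixtures then need no reindexing. *)
Definition mean (R : realType) (T : Type) (nu : seq (R * T)) (f : T -> R) : R :=
  \sum_(q <- nu) q.1 * f q.2.

Definition prob_weights (R : realType) (T : choiceType) (B : {fset T}) (nu : seq (R * T)) :=
  [/\ forall q, q \in nu -> 0 <= q.1, forall q, q \in nu -> q.2 \in B
    & mean nu (fun=> 1) = 1].

Lemma mean_const (R : realType) (T : choiceType) (B : {fset T})
    (nu : seq (R * T)) (c : R) : prob_weights B nu -> mean nu (fun=> c) = c.
Proof.
case=> _ _; rewrite /mean => nu1; rewrite -[RHS]mul1r -nu1 big_distrl /=.
by apply: eq_bigr => q _; rewrite mulr1.
Qed.

Lemma meanB (R : realType) (T : Type) (nu : seq (R * T)) (f g : T -> R) :
  mean nu (fun x => f x - g x) = mean nu f - mean nu g.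
Proof. by rewrite /mean -sumrB; apply: eq_bigr => q _; rewrite mulrBr. Qed.

Lemma le_mean (R : realType) (T : choiceType) (B : {fset T})
    (nu : seq (R * T)) (f g : T -> R) : prob_weights B nu ->
  (forall q, q \in nu -> f q.2 <= g q.2) -> mean nu f <= mean nu g.
Proof.
move=> [nu0 _ _] fg; rewrite /mean !big_seq; apply: ler_sum => q qnu.
by rewrite ler_wpM2l ?nu0 ?fg.
Qed.

Definition osc_le (R : realType) (T : choiceType) (B : {fset T}) (f : T -> R) (w : R) :=
  forall x y, x \in B -> y \in B -> f x - f y <= w.

Lemma osc_le_bounds (R : realType) (T : choiceType) (B : {fset T}) (f : T -> R) (w : R) :
  osc_le B f w -> exists l, forall x, x \in B -> l <= f x <= l + w.
Proof.
move=> fw; have [->|[x0 Bx0]] := fset_0Vmem B; first by exists 0.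
case: (@arg_minP _ _ _ [` Bx0] xpredT (fun x : B => f (val x)) isT) => x _ xmin.
exists (f (val x)) => y By; apply/andP; split.
  by have := xmin [` By] isT.
by have := fw _ _ By (valP x) => ?; lra.
Qed.

(** * The Ramsey property in terms of weighted lists *)

Definition point_mass (R : realType) (G : groupType) (a : G) : fmeasure R G :=
  [fsfun x in [fset a] => 1 | 0].

Lemma finsupp_point_mass (R : realType) (G : groupType) (a : G) :
  finsupp (point_mass R a) = [fset a].
Proof.
apply/fsetP=> x; rewrite mem_finsupp fsfun_fun inE.
by case: ifP; rewrite ?eqxx ?oner_eq0.
Qed.

Lemma point_mass_prob (R : realType) (G : groupType) (a : G) (A : {fset G}) :
  a \in A -> is_prob_on A (point_mass R a).
Proof.
move=> Aa; split.
- by rewrite finsupp_point_mass; apply/fsubsetP=> x; rewrite inE => /eqP->.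
- by move=> x; rewrite fsfun_fun; case: ifP.
- rewrite /fmeasure_of (big_fsetD1 _ Aa) /= big_seq big1 ?addr0.
    by rewrite fsfun_fun inE eqxx.
  by move=> x; rewrite fsfun_fun !inE => /andP[/negbTE->].
Qed.

Lemma point_mass_prod (R : realType) (G : groupType) (a : G) (nu : fmeasure R G)
    (E : {fset G}) :
  fmeasure_of (fmeasure_prod (point_mass R a) nu) E =
  \sum_(y <- finsupp nu | (a * y)%g \in E) nu y.
Proof.
rewrite fmeasure_prodE finsupp_point_mass big_seq_fset1.
by apply: eq_bigr => y _; rewrite fsfun_fun inE eqxx mul1r.
Qed.

(** Testing only Dirac masses at points of [A] turns both Ramsey conditions into pointwise ones. *)
Lemma is_ramsey_weights (R : realType) (G : groupType) (eps : R) (A B E : {fset G}) :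
    is_ramsey eps A B -> E `<=` B ->
  exists nu, [/\ prob_weights B nu,
    forall a q, a \in A -> q \in nu -> (a * q.2)%g \in B &
    osc_le A (fun a => mean nu (fun x => ((a * x)%g \in E)%:R)) eps].
Proof.
move=> ram /ram[nu [[nuB nu0 nu1] nuA nuE]].
exists [seq (nu y, y) | y <- finsupp nu]; split.
- split=> [_ /mapP[y _ ->]|_ /mapP[y ynu ->]|] //=; first exact: (fsubsetP nuB).
  rewrite /mean big_map /=; under eq_bigr do rewrite mulr1.
  rewrite -[RHS]nu1 /fmeasure_of; apply: big_fset_incl => // x _; exact: fsfun_dflt.
(* If [a * y] were outside [B], the translate of [nu] would give it mass [0], yet [nu y] is one of
   the nonnegative terms of that mass and is nonzero. *)
- move=> a _ Aa /mapP[y ynu ->] /=; apply: contraT => ayB.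
  have [sB _ _] := nuA _ (point_mass_prob R Aa).
  have := point_mass_prod a nu [fset (a * y)%g].
  rewrite /fmeasure_of big_seq_fset1 fsfun_dflt; last first.
    by apply: contra ayB => /(fsubsetP sB).
  move/esym/eqP; rewrite psumr_eq0 // => /allP/(_ y ynu).
  by rewrite !inE eqxx /= => /eqP nuy; rewrite mem_finsupp nuy eqxx in ynu.
- move=> a a' Aa Aa'.
  have := nuE _ _ (point_mass_prob R Aa) (point_mass_prob R Aa').
  rewrite !point_mass_prod => /(le_trans (ler_norm _)).
  rewrite /mean !big_map /=.
  by under [in X in _ -> X]eq_bigr do rewrite mulr_natr mulrb;
     under [X in _ -> _ - X <= _]eq_bigr do rewrite mulr_natr mulrb; rewrite -!big_mkcond.
Qed.

(** * Contraction of oscillation, once and iterated *)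

Definition shifted_mean (R : realType) (G : groupType) (nu : seq (R * G))
  (f : G -> R) (a : G) : R := mean nu (fun x => f (a * x)%g).

(** The condition that [P(A) nu] lies in [P(B)], tested on points. *)
Definition shifts_into (R : realType) (G : groupType) (A B : {fset G})
  (nu : seq (R * G)) := forall a q, a \in A -> q \in nu -> (a * q.2)%g \in B.

(** Averaging over translates inside [B] never increases oscillation, so a step aimed at one
    function does not spoil the others. *)
Lemma osc_le_shifted_mean (R : realType) (G : groupType) (A B : {fset G})
    (nu : seq (R * G)) (f : G -> R) (w : R) :
  prob_weights B nu -> shifts_into A B nu -> osc_le B f w ->
  osc_le A (shifted_mean nu f) w.
Proof.
move=> nuP nuAB fw a a' Aa Aa'; rewrite /shifted_mean -meanB -[leRHS](mean_const w nuP).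
by apply: (le_mean nuP) => q qnu; apply: fw; apply: nuAB.
Qed.

(* Thresholding [f] at the midpoint of its range [[l, l + w]] sandwiches it
   between [l + w/2 1_E] and [l + w/2 + w/2 1_E]. *)
Lemma ramsey_contracts_osc (R : realType) (G : groupType) (A B : {fset G})
    (f : G -> R) (w : R) : 0 <= w ->
    is_ramsey (1 / 2 : R) A B -> osc_le B f w ->
  exists nu, [/\ prob_weights B nu, shifts_into A B nu
    & osc_le A (shifted_mean nu f) (3 / 4 * w)].
Proof.
move=> w0 ram /osc_le_bounds[l lf].
pose E := [fset x in B | l + w / 2 <= f x].
have EB : E `<=` B by apply/fsubsetP=> x; rewrite !inE => /andP[].
have [nu [nuP nuAB nuE]] := is_ramsey_weights ram EB.
exists nu; split=> // a a' Aa Aa'.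
pose e a := mean nu (fun x => ((a * x)%g \in E)%:R) : R.
have meanE c b a0 : mean nu (fun x => c + b * ((a0 * x)%g \in E)%:R) = c + b * e a0.
  rewrite -[in RHS](mean_const c nuP) /e /mean big_distrr -big_split /=.
  by apply: eq_bigr => q _; rewrite mulrDr mulrCA.
have up : shifted_mean nu f a <= l + w / 2 + w / 2 * e a.
  rewrite -meanE; apply: (le_mean nuP) => q qnu.
  have Baq := nuAB _ _ Aa qnu; have /andP[_ fl] := lf _ Baq.
  by rewrite !inE Baq /=; case: (leP (l + w / 2) _) => ? /=; lra.
have lo : l + w / 2 * e a' <= shifted_mean nu f a'.
  rewrite -meanE; apply: (le_mean nuP) => q qnu.
  have Baq := nuAB _ _ Aa' qnu; have /andP[fl _] := lf _ Baq.
  by rewrite !inE Baq /=; case: (leP (l + w / 2) _) => ? /=; lra.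
(* The sandwich loses [w / 2] and the Ramsey bound adds half of [w / 2], hence [3 / 4 * w]. *)
have : e a - e a' <= 1 / 2 by exact: nuE.
by move=> ?; nra.
Qed.

Definition weights_conv (R : realType) (G : groupType) (mu nu : seq (R * G)) :=
  [seq (q.1 * q'.1, (q.2 * q'.2)%g) | q <- mu, q' <- nu].

Lemma mean_conv (R : realType) (G : groupType) (mu nu : seq (R * G)) (f : G -> R) :
  mean (weights_conv mu nu) f = mean mu (shifted_mean nu f).
Proof.
rewrite /mean /weights_conv big_allpairs_dep; apply: eq_bigr => q _.
by rewrite /shifted_mean /mean big_distrr; apply: eq_bigr => q' _ /=; rewrite mulrA.
Qed.

(** By associativity, successive averaging is averaging over the convolution; this merges all Ramsey
    steps into one measure. *)
Lemma shifted_mean_conv (R : realType) (G : groupType) (mu nu : seq (R * G))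
    (f : G -> R) (a : G) :
  shifted_mean (weights_conv mu nu) f a = shifted_mean mu (shifted_mean nu f) a.
Proof.
rewrite /shifted_mean mean_conv; congr mean; apply/funext => x.
by rewrite /shifted_mean; congr mean; apply/funext => y; rewrite mulgA.
Qed.

Lemma prob_weights_conv (R : realType) (G : groupType) (A B : {fset G})
    (mu nu : seq (R * G)) : prob_weights A mu -> prob_weights B nu ->
  shifts_into A B nu -> prob_weights B (weights_conv mu nu).
Proof.
move=> [mu0 muA mu1] [nu0 nuB nu1] nuAB; split=> [q|q|].
- by move=> /allpairsP[[p p'] [/= pmu pnu ->]] /=; apply: mulr_ge0; [apply: mu0 | apply: nu0].
- by move=> /allpairsP[[p p'] [/= pmu pnu ->]] /=; apply: nuAB => //; apply: muA.
- by rewrite mean_conv -[RHS]mu1; congr mean; apply/funext => x.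
Qed.

Lemma one_in_word_ball (G : groupType) (S : {fset G}) (n : nat) :
  (1 : G)%g \in word_ball S n.
Proof.
rewrite in_word_ball; apply/word_length_le; exists [::].
by rewrite /word_prod big_nil.
Qed.

Lemma generator_in_word_ball (G : groupType) (S : {fset G}) (a : G) (n : nat) :
  a \in S -> a \in word_ball S n.+1.
Proof.
move=> Sa; rewrite in_word_ball; apply/word_length_le; exists [:: a].
by rewrite /word_prod big_seq1 /= Sa.
Qed.

(** [js] lists which function each step contracts. Steps descend from the ball of radius [N] to that
    of radius [m], and the measures used are convolved. *)
Lemma ramsey_iter_contracts (R : realType) (G : groupType) (S : {fset G})
    (I : eqType) (js : seq I) (m N : nat) (f : I -> G -> R) (w : I -> R) :
    ramsey_iter R S (size js) (Some m) = Some N ->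
    (forall i, 0 <= w i) -> (forall i, osc_le (word_ball S N) (f i) (w i)) ->
  exists nu, [/\ prob_weights (word_ball S N) nu,
    shifts_into (word_ball S m) (word_ball S N) nu &
    forall i, osc_le (word_ball S m) (shifted_mean nu (f i))
                ((3 / 4) ^+ count_mem i js * w i)].
Proof.
elim: js N f w => [|j js IHjs] N f w /=.
  (* With no step left, the Dirac mass at the identity serves. *)
  case=> <- w0 fw; exists [:: (1, 1%g)]; split.
  - split=> [q|q|]; rewrite ?inE; last by rewrite /mean big_seq1 mulr1.
      by move=> /eqP->.
    by move=> /eqP->; apply: one_in_word_ball.
  - by move=> a q Aa; rewrite inE => /eqP->; rewrite mulg1.
  - move=> i; rewrite expr0 mul1r => a b Aa Ab.
    by rewrite /shifted_mean /mean !big_seq1 /= !mul1r !mulg1; apply: fw.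
(* [N] is the Ramsey radius of [N']: the step on [j] trades functions on the ball of radius [N] for
   functions on that of radius [N']. *)
rewrite /ramsey_iter /=; case E: (iter _ _ _) => [N'|] //= /enat_min_Some[ram _] w0 fw.
have [nu [nuP nuI nuw]] := ramsey_contracts_osc (w0 j) ram (fw j).
pose w' i := if i == j then 3 / 4 * w i else w i.
have [] := IHjs N' (fun i => shifted_mean nu (f i)) w' E.
- by move=> i; rewrite /w'; case: ifP => // _; rewrite mulr_ge0 // divr_ge0.
- move=> i; rewrite /w'; case: eqP => [->//|_].
  exact: osc_le_shifted_mean nuP nuI (fw i).
move=> mu [muP muI muw]; exists (weights_conv mu nu); split.
- exact: prob_weights_conv muP nuP nuI.
- move=> a q Aa /allpairsP[[p p'] [/= pmu pnu ->]] /=; rewrite mulgA.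
  by apply: nuI => //; apply: muI.
- move=> i a b Aa Ab; rewrite !shifted_mean_conv.
  have := muw i a b Aa Ab; rewrite /w' [i == j]eq_sym.
  case: eqP => _ /=; first by rewrite add1n exprSr -[_ ^+ _ * _ * _]mulrA.
  by rewrite add0n.
Qed.

(** * Point masses and an almost invariant measure *)

Definition mass (R : realType) (T : eqType) (nu : seq (R * T)) (g : T) : R :=
  mean nu (fun x => (x == g)%:R).

Lemma sum_mass (R : realType) (T : choiceType) (B : {fset T}) (nu : seq (R * T))
    (f : T -> R) : (forall q, q \in nu -> q.2 \in B) ->
  \sum_(g <- B) f g * mass nu g = mean nu f.
Proof.
move=> nuB; rewrite /mass /mean.
under eq_bigr do rewrite big_distrr.
rewrite exchange_big /= !big_seq; apply: eq_bigr => q qnu.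
rewrite (big_fsetD1 _ (nuB _ qnu)) /= eqxx mulr1 mulrC.
rewrite big_seq big1 ?addr0 // => x; rewrite !inE eq_sym => /andP[/negbTE-> _].
by rewrite !mulr0.
Qed.

Lemma mass_ge0 (R : realType) (T : choiceType) (B : {fset T}) (nu : seq (R * T)) g :
  prob_weights B nu -> 0 <= mass nu g.
Proof.
by case=> nu0 _ _; rewrite /mass /mean big_seq; apply: sumr_ge0 => q /nu0 q0;
  rewrite mulr_ge0.
Qed.

Lemma mass_le1 (R : realType) (T : choiceType) (B : {fset T}) (nu : seq (R * T)) g :
  prob_weights B nu -> mass nu g <= 1.
Proof.
move=> nuP; rewrite -(mean_const 1 nuP); apply: (le_mean nuP) => q _.
by case: eqP.
Qed.

Lemma mass_out (R : realType) (T : choiceType) (B : {fset T}) (nu : seq (R * T)) g :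
  prob_weights B nu -> g \notin B -> mass nu g = 0.
Proof.
case=> _ nuB _ gB; rewrite /mass /mean big_seq big1 // => q /nuB qB.
by case: eqP => [qg|_]; rewrite ?mulr0 //; rewrite -qg qB in gB.
Qed.

Lemma mass_shift (R : realType) (G : groupType) (nu : seq (R * G)) (a g : G) :
  mass nu (a^-1 * g)%g = mass [seq (q.1, (a * q.2)%g) | q <- nu] g.
Proof.
rewrite /mass /mean big_map; apply: eq_bigr => q _ /=; congr (_ * (_ : bool)%:R).
by rewrite eq_sym -(inj_eq (mulgI a)) mulVKg eq_sym.
Qed.

Definition mix (R : realType) (T : Type) (t : R) (mu nu : seq (R * T)) :=
  [seq ((1 - t) * q.1, q.2) | q <- mu] ++ [seq (t * q.1, q.2) | q <- nu].

Lemma mean_mix (R : realType) (T : Type) (t : R) (mu nu : seq (R * T)) (f : T -> R) :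
  mean (mix t mu nu) f = (1 - t) * mean mu f + t * mean nu f.
Proof.
rewrite /mean big_cat /= !big_map !big_distrr /=.
by congr +%R; apply: eq_bigr => q _; rewrite mulrA.
Qed.

Lemma mix_supp (R : realType) (T : choiceType) (t : R) (mu nu : seq (R * T)) q :
  q \in mix t mu nu -> exists2 q', (q' \in mu) || (q' \in nu) & q.2 = q'.2.
Proof.
by rewrite mem_cat => /orP[] /mapP[p pmu ->]; exists p; rewrite ?pmu ?orbT.
Qed.

Lemma prob_weights_mix (R : realType) (T : choiceType) (B : {fset T}) (t : R)
    (mu nu : seq (R * T)) : 0 <= t <= 1 ->
  prob_weights B mu -> prob_weights B nu -> prob_weights B (mix t mu nu).
Proof.
move=> /andP[t0 t1] [mu0 muB mu1] [nu0 nuB nu1]; split=> [q|q|].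
- rewrite mem_cat => /orP[] /mapP[p pP ->] /=; apply: mulr_ge0 => //.
  + by rewrite subr_ge0.
  + exact: mu0.
  + exact: nu0.
- by case/mix_supp => p /orP[/muB|/nuB] ? ->.
- by rewrite mean_mix mu1 nu1 !mulr1 subrK.
Qed.

(** The minimax runs over coordinates [(a, g)]. A test function on these is a family of functions of
    [g], one per generator, and [p] Ramsey steps for each bound its contribution by
    [(3 / 4) ^+ p]. *)
Lemma almost_invariant_weights (R : realType) (G : groupType) (S : {fset G})
    (p N : nat) (c : R) :
    ramsey_iter R S (p * #|` S|) (Some 1%N) = Some N ->
    #|` S|%:R * (3 / 4) ^+ p < c ->
  exists nu, [/\ prob_weights (word_ball S N) nu,
    shifts_into S (word_ball S N) nu &
    \sum_(a <- S) \sum_(g <- word_ball S N)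
      Num.max 0 (mass nu (a^-1 * g)%g - mass nu g) < c].
Proof.
move=> RN Sc; set B := word_ball S N.
pose good (nu : seq (R * G)) := prob_weights B nu /\ shifts_into S B nu.
pose X (x : G * G -> R) := exists2 nu : seq (R * G), good nu &
  x = fun i => mass nu (i.1^-1 * i.2)%g - mass nu i.2.
(* Half of the available slack, so that the final inequality stays strict. *)
pose e := (c - #|` S|%:R * (3 / 4) ^+ p) / 2.
have e0 : 0 < e by rewrite /e; lra.
have [] := @minimax_pos_part R _ [seq (a, g) | a <- S, g <- B] X
  (#|` S|%:R * (3 / 4) ^+ p) e _ _ _ e0.
- move=> _ i [nu [nuP _] ->]; rewrite ler_norml.
  have := mass_ge0 i.2 nuP; have := mass_le1 i.2 nuP.
  have := mass_ge0 (i.1^-1 * i.2)%g nuP; have := mass_le1 (i.1^-1 * i.2)%g nuP.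
  by move=> *; apply/andP; split; lra.
- move=> _ _ t [mu [muP muI] ->] [nu [nuP nuI] ->] t01.
  exists (mix t mu nu).
    split; first exact: prob_weights_mix.
    by move=> a q Sa /mix_supp[q' /orP[/(muI _ _ Sa)|/(nuI _ _ Sa)] ? ->].
  by apply/funext => i; rewrite /mass !mean_mix; ring.
- move=> f f01.
  pose F a g := if g \in B then f (a, g) else 0.
  (* Each generator occurs exactly [p] times, so the length is the number of iterations. *)
  pose js := flatten (nseq p (enum_fset S)).
  have sjs : size js = (p * #|` S|)%N.
    by rewrite /js size_flatten /shape map_nseq sumn_nseq mulnC.
  have [] := @ramsey_iter_contracts R G S G js 1 N F (fun=> 1).
  + by rewrite sjs.
  + by [].
  + move=> a x y _ _; rewrite /F.
    have /andP[? ?] := f01 (a, x); have /andP[? ?] := f01 (a, y).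
    by case: ifP; case: ifP => _ _; lra.
  move=> nu [nuP nuI nuF].
  have SB a : a \in S -> a \in word_ball S 1 by exact: generator_in_word_ball.
  exists (fun i => mass nu (i.1^-1 * i.2)%g - mass nu i.2).
    by exists nu => //; split=> // a q /SB; apply: nuI.
  have -> : #|` S|%:R * (3 / 4) ^+ p = \sum_(a <- S) (3 / 4 : R) ^+ p.
    by rewrite big_const_seq count_predT iter_addr_0 mulr_natl.
  rewrite big_allpairs /= !big_seq; apply: ler_sum => a Sa.
  (* The shift moves from the mass onto the function. *)
  have -> : \sum_(g <- B) f (a, g) * (mass nu (a^-1 * g)%g - mass nu g) =
      shifted_mean nu (F a) a - shifted_mean nu (F a) 1%g.
    rewrite [in X in _ - X]/shifted_mean.
    under [in X in _ - X]eq_fun do rewrite mul1g.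
    have [_ nuB _] := nuP.
    rewrite -(sum_mass _ nuB).
    have -> : shifted_mean nu (F a) a = mean [seq (q.1, (a * q.2)%g) | q <- nu] (F a).
      by rewrite /shifted_mean /mean big_map.
    rewrite -(@sum_mass _ _ B); last first.
      by move=> _ /mapP[q qnu ->]; apply: nuI => //; apply: SB.
    rewrite -sumrB !big_seq; apply: eq_bigr => g Bg.
    by rewrite /F Bg mass_shift mulrBr.
  (* Both [a] and the identity lie in the ball of radius 1, which is why the iteration starts at
     [1]. *)
  have := nuF a _ _ (SB _ Sa) (one_in_word_ball S 1).
  by rewrite /js count_flatten map_nseq sumn_nseq count_uniq_mem ?fset_uniq // Sa mul1n mulr1.
move=> x [nu [nuP nuI] ->]; rewrite big_allpairs /= => xle.
by exists nu; split=> //; apply: le_lt_trans xle _; rewrite /e; lra.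
Qed.

(** * Extracting a level set *)

Lemma mass_gt0 (R : realType) (T : eqType) (nu : seq (R * T)) (g : T) :
  0 < mass nu g -> exists2 q, q \in nu & q.2 = g.
Proof.
case: (boolP (has (fun q => q.2 == g) nu)) => [/hasP[q qnu /eqP qg] _|/hasPn nug].
  by exists q.
rewrite /mass /mean big_seq big1 ?ltxx // => q /nug /negbTE->.
by rewrite mulr0.
Qed.

Lemma natr_card_sep (R : realType) (T : choiceType) (X : {fset T}) (P : pred T) :
  #|` [fset x in X | P x]|%:R = \sum_(x <- X) (P x)%:R :> R.
Proof.
rewrite card_fset_sum1 natr_sum -[RHS](@big_fset_incl _ _ _ _ [fset x in X | P x]).
- rewrite big_seq [RHS]big_seq; apply: eq_bigr => x.
  by rewrite !inE => /andP[_ ->].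
- by apply/fsubsetP=> x; rewrite !inE => /andP[].
- by move=> x Xx; rewrite !inE Xx /= => /negbTE->.
Qed.

(* Induction on the size of the support of [h]: with [t] the least positive
   value of [h] and [P] its support, both sides of the inequality split
   according to [h = t 1_P + max(0, h - t)]. *)
Lemma exists_folner_level_set (R : realType) (G : groupType) (S X : {fset G})
    (eps : R) (h : G -> R) :
    (forall g, 0 <= h g) -> (forall g, g \notin X -> h g = 0) ->
    \sum_(a <- S) \sum_(g <- X) Num.max 0 (h (a^-1 * g)%g - h g)
      < eps * \sum_(g <- X) h g ->
  exists B, [/\ B != fset0, forall g, g \in B -> 0 < h g &
    \sum_(a <- S) #|` [fset g in X | ((a^-1 * g)%g \in B) && (g \notin B)]|%:R
      <= eps * #|` B|%:R].
Proof.
have [n] := ubnP #|` [fset g in X | 0 < h g]|.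
elim: n h => // n IHn h; set P := [fset g in X | 0 < h g] => Pn h0 hX hlt.
have PE g : (g \in P) = (0 < h g).
  by rewrite !inE /=; case: (boolP (g \in X)) => // /hX ->; rewrite ltxx.
have hP g : g \notin P -> h g = 0.
  by rewrite PE -leNgt => hg; apply/eqP; rewrite eq_le hg h0.
have [P0|[g0 Pg0]] := fset_0Vmem P.
  have hz g : h g = 0 by apply: hP; rewrite P0.
  move: hlt; rewrite [X in _ * X]big1 // mulr0 ltNge => /negP[].
  by apply: sumr_ge0 => a _; apply: sumr_ge0 => g _; rewrite le_max lexx.
case: (@arg_minP _ _ _ [` Pg0] xpredT (fun x : P => h (val x)) isT) => x _ xmin.
set t := h (val x) in xmin.
have t0 : 0 < t by rewrite -PE; apply: valP.
have tmin g : g \in P -> t <= h g by move=> Pg; exact: (xmin [` Pg] isT).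
(* Either [P] is already the required set, or its boundary is too large and removing the layer
   [t 1_P] keeps the strict inequality for [h']. *)
have [Pgood|Pbad] := leP (\sum_(a <- S)
    #|` [fset g in X | ((a^-1 * g)%g \in P) && (g \notin P)]|%:R) (eps * #|` P|%:R).
  exists P; split=> [|g|//]; last by rewrite PE.
  by apply/fset0Pn; exists g0.
pose h' g := Num.max 0 (h g - t).
have h'P g : h g = h' g + t * (g \in P)%:R.
  rewrite /h'; case: (boolP (g \in P)) => [/tmin|/hP ->].
    by case: (leP 0 (h g - t)) => ? ? /=; lra.
  by case: (leP 0 (0 - t)) => ? /=; lra.
have h'0 g : g \notin P -> h' g = 0.
  by move=> gP; have := h'P g; rewrite (hP _ gP) (negbTE gP) mulr0 addr0.
have h'_ge0 g : 0 <= h' g by rewrite le_max lexx.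
have [||||B [B0 Bh' BS]] := IHn h'.
(* The point [x] attaining [t] leaves the support. *)
- rewrite -ltnS; apply: leq_trans Pn; rewrite ltnS; apply: fproper_ltn_card.
  rewrite fproperE; apply/andP; split.
    apply/fsubsetP=> g; rewrite !inE => /andP[-> /=].
    by apply: contraTT => ?; rewrite h'0 ?ltxx // PE.
  apply/negP => /fsubsetP/(_ (val x) (valP x)).
  by rewrite !inE /h' subrr maxxx ltxx andbF.
- by [].
- by move=> g gX; apply: h'0; rewrite PE hX // ltxx.
(* A discrete coarea identity: the layer contributes [t] exactly when [u] is inside [P] and [v]
   outside. *)
- have posE u v : Num.max 0 (h u - h v) =
      Num.max 0 (h' u - h' v) + t * ((u \in P) && (v \notin P))%:R.
    rewrite !h'P; have := h'_ge0 u; have := h'_ge0 v; have := h'0 u; have := h'0 v.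
    case: (u \in P); case: (v \in P) => /= vz uz v0 u0; rewrite ?mulr1 ?mulr0 ?addr0.
    + by congr Num.max; ring.
    + by rewrite vz // !subr0 !max_r // addr_ge0 // ltW.
    + by rewrite uz // !max_l //; lra.
    + by [].
  have hsum : \sum_(g <- X) h g = \sum_(g <- X) h' g + t * #|` P|%:R.
    under eq_bigr do rewrite h'P.
    rewrite big_split -big_distrr /=; congr (_ + _ * _).
    rewrite /P natr_card_sep; apply: eq_bigr => g _; by rewrite PE.
  have Ssum : \sum_(a <- S) \sum_(g <- X) Num.max 0 (h (a^-1 * g)%g - h g) =
      \sum_(a <- S) \sum_(g <- X) Num.max 0 (h' (a^-1 * g)%g - h' g) +
      t * \sum_(a <- S) #|` [fset g in X | ((a^-1 * g)%g \in P) && (g \notin P)]|%:R.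
    rewrite big_distrr -big_split /=; apply: eq_bigr => a _.
    rewrite natr_card_sep big_distrr -big_split /=; apply: eq_bigr => g _.
    exact: posE.
  move: hlt; rewrite hsum Ssum => ?.
  have : t * (eps * #|` P|%:R) < t * \sum_(a <- S)
    #|` [fset g in X | ((a^-1 * g)%g \in P) && (g \notin P)]|%:R by rewrite ltr_pM2l.
  by move=> ?; lra.
exists B; split=> // g /Bh' h'g; rewrite h'P.
by rewrite ltr_wpDr // mulr_ge0 // ltW.
Qed.

(** * Counting and conclusion *)

Lemma card_word_ball (G : groupType) (S : {fset G}) (n : nat) :
  (#|` word_ball S n| <= (2 * #|` S| + 1) ^ n)%N.
Proof.
(* The letter [1] pads shorter words, so every element of the ball is a product of exactly [n]
   letters; it accounts for the [+ 1] in the base. *)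
pose L := (1%g : G) |` (S `|` [fset (x^-1)%g | x in S]).
have cardL : (#|` L| <= 2 * #|` S| + 1)%N.
  rewrite /L cardfsU1 addnC leq_add ?leq_b1 // cardfsU mul2n -addnn.
  apply: leq_trans (leq_subr _ _) _; rewrite leq_add2l.
  exact: leq_imfset_card.
elim: n => [|n IHn].
  rewrite expn0 -(cardfs1 (1 : G)%g); apply: fsubset_leq_card; apply/fsubsetP=> g.
  rewrite in_word_ball => /word_length_le[[|x w] [_ <- //]].
  by move=> _; rewrite /word_prod big_nil inE.
rewrite expnS; apply: leq_trans (leq_mul cardL IHn).
rewrite -(size_allpairs (fun x y => x * y)%g).
pose s := [seq (x * y)%g | x <- L, y <- word_ball S n].
apply: leq_trans (size_undup s); rewrite -(size_seq_fset tt s).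
apply: fsubset_leq_card; apply/fsubsetP=> g; rewrite seq_fsetE.
rewrite in_word_ball => /word_length_le[[|x w] [/= Sw <- wn]]; apply/allpairsP.
  exists (1%g, 1%g); rewrite /= !inE eqxx one_in_word_ball.
  by rewrite /word_prod big_nil mulg1.
have /andP[Sx Sw'] := Sw.
exists (x, word_prod w); rewrite /= /word_prod big_cons; split=> //; last first.
  by rewrite in_word_ball; apply/word_length_le; exists w.
case/orP: Sx => Sx; rewrite !inE ?Sx ?orbT //; apply/orP; right; apply/orP; right.
by apply/imfsetP; exists (x^-1)%g; rewrite ?invgK.
Qed.

(** A translate has the size of [B], so the two one-sided differences are equally large. This is the
    source of the factor 2 between [1 / k] and [1 / (2 * k)]. *)
Lemma card_symdiff_translate (G : groupType) (a : G) (B : {fset G}) :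
  #|` fset_symdiff (fset_translate a B) B| = (2 * #|` fset_translate a B `\` B|)%N.
Proof.
have cardaB : #|` fset_translate a B| = #|` B| by rewrite card_imfset //; apply: mulgI.
rewrite /fset_symdiff cardfsU; set I := _ `&` _.
have -> : I = fset0.
  by apply/fsetP=> x; rewrite !inE; case: (x \in B); rewrite ?andbF ?andbT //= andbC.
rewrite cardfs0 subn0 mul2n -addnn; congr addn.
by rewrite !cardfsD fsetIC cardaB.
Qed.

Theorem theorem3p2 (R : realType) (G : groupType) (S : {fset G})
    (S_neq0 : S != fset0) (S_gen : generates S) (k p : nat) (k_ge1 : (1 <= k)%N)
    (kp : (3 / 4) ^+ p < 1 / (2 * k%:R * #|` S|%:R) :> R) :
  enat_le (folner_fun R S k)
    (enat_exp (2 * #|` S| + 1) (ramsey_iter R S (p * #|` S|) (Some 1%N))).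
Proof.
case RN: (ramsey_iter _ _ _ _) => [N|] /=; last by case: folner_fun.
have k0 : 0 < k%:R :> R by rewrite ltr0n.
have s0 : 0 < #|` S|%:R :> R by rewrite ltr0n cardfs_gt0.
have sp : #|` S|%:R * (3 / 4) ^+ p < 1 / (2 * k%:R) :> R.
  move: kp; rewrite ltr_pdivlMr; last by rewrite !mulr_gt0.
  by rewrite ltr_pdivlMr ?mulr_gt0 // => ?; nra.
have [nu [nuP nuI nuS]] := almost_invariant_weights RN sp.
set X := word_ball S N in nuP nuI nuS.
have [|||B [B0 Bnu BS]] := @exists_folner_level_set R G S X (1 / (2 * k%:R)) (mass nu).
- by move=> g; apply: mass_ge0 nuP.
- by move=> g; apply: mass_out nuP.
- suff -> : \sum_(g <- X) mass nu g = 1 by rewrite mulr1.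
  have [_ nuX nu1] := nuP; rewrite -[RHS]nu1 -(sum_mass _ nuX).
  by apply: eq_bigr => g _; rewrite mul1r.
have folB : is_folner (1 / k%:R : R) S B.
  split=> //.
  (* Points of [B] carry positive mass, so [shifts_into] keeps their translates in [X], and counting
     the boundary inside [X] misses nothing. *)
  have aBE a : a \in S -> fset_translate a B `\` B =
      [fset g in X | ((a^-1 * g)%g \in B) && (g \notin B)].
    move=> Sa; apply/fsetP=> g; rewrite !inE /= andbC andbA; congr (_ && _).
    apply/imfsetP/andP => [[b /= Bb ->]|[_ Bag]]; last first.
      by exists (a^-1 * g)%g; rewrite ?mulVKg.
    rewrite mulKg; split=> //.
    by have [q qnu <-] := mass_gt0 (Bnu _ Bb); apply: nuI.
  rewrite big_seq; under eq_bigr => a Sa do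
    rewrite card_symdiff_translate (aBE _ Sa) natrM.
  rewrite -big_seq -big_distrr /=.
  have -> : 1 / k%:R * #|` B|%:R = 2 * (1 / (2 * k%:R) * #|` B|%:R) :> R.
    by field; rewrite gt_eqF.
  by rewrite ler_pM2l.
have cardB : (#|` B| <= (2 * #|` S| + 1) ^ N)%N.
  apply: leq_trans (card_word_ball S N); apply: fsubset_leq_card.
  (* [nu] has no mass outside the ball, so [B] lies in it. *)
  apply/fsubsetP=> g /Bnu; apply: contraTT => /(mass_out nuP) ->.
  by rewrite ltxx.
case E: (folner_fun _ _ _) => [f|] /=.
  have /enat_min_Some[_ fmin] := E.
  by apply: leq_trans cardB; apply: fmin; exists B.
by have /enat_min_None/(_ #|` B|) := E; case; exists B.
Qed.
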